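(* Let $\Lambda$ be the (countable) vertex set of a countable graph, $\Phi$ a nonempty finite set, $\Omega=\Phi^{\Lambda}$ with the $\sigma$-algebra $\mathcal F$ generated by the finite-dimensional cylinder sets, and let $\mu$ be a probability measure on $(\Omega,\mathcal F)$ with $\mu(B)>0$ for every nonempty finite-dimensional cylinder set $B$. Let $M\subset\Lambda$ be any finite set, put $m=|\Phi|^{|M|}$, let $\Omega_1,\dots,\Omega_m$ be the partition of $\Omega$ determined by $M$, and let $W$ be the associated cubic stochastic operator on the set $S(\Omega,\Phi)$ of probability measures on $(\Omega,\mathcal F)$ (all as defined in the context). Then the dynamical system generated by $W$ is reducible to a dynamical system generated by a Volterra cubic stochastic operator acting on the $(m-1)$-dimensional simplex $S^{m-1}$, in the following sense. The map $V$ on $S^{m-1}$ given by $$V(x)_l=\sum_{i=1}^{m}a_i(\Omega_l)x_i^3+3\sum_{i=1}^m\sum_{\substack{j=1\\ j\ne i}}^m b_{ij}(\Omega_l)x_i^2x_j+6\sum_{1\le i<j<k\le m}c_{ijk}(\Omega_l)x_ix_jx_k,\qquad l=1,\dots,m,$$ is a Volterra cubic stochastic operator on $S^{m-1}$, and for every $\lambda\in S(\Omega,\Phi)$, writing $\lambda^{(n)}=W^n\lambda$ (with $\lambda^{(0)}=\lambda$) and $\lambda^{(n)}_i=\lambda^{(n)}(\Omega_i)$, one has for all $n\ge 0$ $$(\lambda^{(n)}_1,\dots,\lambda^{(n)}_m)=V^n\big(\lambda(\Omega_1),\dots,\lambda(\Omega_m)\big)$$ and, for all $A\in\mathcal F$,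 $$\lambda^{(n+1)}(A)=\sum_{i=1}^{m}a_i(A)(\lambda_i^{(n)})^3+3\sum_{i=1}^m\sum_{\substack{j=1\\ j\ne i}}^m b_{ij}(A)(\lambda_i^{(n)})^2\lambda_j^{(n)}+6\sum_{1\le i<j<k\le m}c_{ijk}(A)\lambda^{(n)}_i\lambda^{(n)}_j\lambda^{(n)}_k .$$
   Context: Simplex: $S^{m-1}=\{x\in\mathbb R^m: x_i\ge 0,\ \sum_{i=1}^m x_i=1\}$. A cubic stochastic operator (CSO) on $S^{m-1}$ is a map $x\mapsto x'$ of the form $x'_l=\sum_{i,j,k=1}^m P_{ijk,l}x_ix_jx_k$ $(l=1,\dots,m)$ with $P_{ijk,l}\ge 0$ and $\sum_{l=1}^m P_{ijk,l}=1$ for all $i,j,k$. It is called Volterra if $P_{ijk,l}$ may be nonzero only when $l\in\{i,j,k\}$, i.e. $P_{ijk,l}=0$ whenever $l\notin\{i,j,k\}$. Partition: $\Omega$ is the set of all functions $\sigma:\Lambda\to\Phi$. Two elements $\sigma,\varphi\in\Omega$ are equivalent if $\sigma(x)=\varphi(x)$ for all $x\in M$; $\Omega_1,\dots,\Omega_m$, $m=|\Phi|^{|M|}$, denote the equivalence classes (so each $\Omega_i$ is a nonempty cylinder set and $\mu(\Omega_i)>0$). Kernel and operator: for $\sigma_1\in\Omega_i$, $\sigma_2\in\Omega_j$, $\sigma_3\in\Omega_k$ (indices $i,j,k$ not necessarily distinct) and $A\in\mathcal F$ put $$P(\sigma_1,\sigma_2,\sigma_3,A)=\frac{\mu(\Omega_i)\mu(A\cap\Omega_i)+\mu(\Omega_j)\mu(A\cap\Omega_j)+\mu(\Omega_k)\mu(A\cap\Omega_k)}{\mu(\Omega_i)^2+\mu(\Omega_j)^2+\mu(\Omega_k)^2}.$$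 (This is the normalization to total mass $1$ of the measure with $\mu$-density $\sigma\mapsto \frac{(\delta_{il}+\delta_{jl}+\delta_{kl})\mu(\Omega_l)}{\mu(\Omega_i)+\mu(\Omega_j)+\mu(\Omega_k)}$ for $\sigma\in\Omega_l$, where $\delta$ is the Kronecker symbol.) The operator $W$ sends a probability measure $\lambda$ on $(\Omega,\mathcal F)$ to the probability measure $W\lambda$ given by $$(W\lambda)(A)=\int_\Omega\int_\Omega\int_\Omega P(\sigma_1,\sigma_2,\sigma_3,A)\,d\lambda(\sigma_1)\,d\lambda(\sigma_2)\,d\lambda(\sigma_3),\qquad A\in\mathcal F.$$ Coefficients: for $A\in\mathcal F$, $$a_i(A)=\frac{\mu(A\cap\Omega_i)}{\mu(\Omega_i)},\qquad b_{ij}(A)=\frac{2\mu(\Omega_i)\mu(A\cap\Omega_i)+\mu(\Omega_j)\mu(A\cap\Omega_j)}{2\mu(\Omega_i)^2+\mu(\Omega_j)^2},$$ $$c_{ijk}(A)=\frac{\mu(\Omega_i)\mu(A\cap\Omega_i)+\mu(\Omega_j)\mu(A\cap\Omega_j)+\mu(\Omega_k)\mu(A\cap\Omega_k)}{\mu(\Omega_i)^2+\mu(\Omega_j)^2+\mu(\Omega_k)^2}.$$ *)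

(* Defs.v *)
From HB Require Import structures.
From mathcomp Require Import all_boot all_order all_algebra finmap.
From mathcomp Require Import all_classical all_reals all_analysis.
From mathcomp Require Import measurable_realfun.

Set Implicit Arguments.
Unset Strict Implicit.
Unset Printing Implicit Defensive.

Import Order.TTheory GRing.Theory Num.Theory.
Import numFieldNormedType.Exports.

Local Open Scope classical_set_scope.
Local Open Scope ring_scope.

Section Simplex.
Context {R : realType} {m : nat}.

Definition simplex : set 'rV[R]_m :=
  [set x | (forall i, 0 <= x ord0 i) /\ \sum_i x ord0 i = 1].

(* The coefficient P_{ijk,l} is written P i j k l. *)
Implicit Type P : 'I_m -> 'I_m -> 'I_m -> 'I_m -> R.

Definition stochastic_coef P :=
  (forall i j k l, 0 <= P i j k l) /\ (forall i j k, \sum_l P i j k l = 1).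

Definition cso P (x : 'rV[R]_m) : 'rV[R]_m :=
  \row_l \sum_i \sum_j \sum_k
    P i j k l * x ord0 i * x ord0 j * x ord0 k.

Definition volterra_coef P :=
  forall i j k l, l \notin [:: i; j; k] -> P i j k l = 0.

(* The operators of interest are maps on the simplex, so only the values of V
   there matter. *)
Definition volterra_cso (V : 'rV[R]_m -> 'rV[R]_m) :=
  exists P, [/\ stochastic_coef P, volterra_coef P &
    forall x, simplex x -> V x = cso P x].

End Simplex.

Section Config.
Context (Lambda : countType) (Phi : finType).

(* The nonemptiness proof is a parameter of the type because measurable types
   have to be pointed; the sigma-algebra does not depend on it. *)
Definition config (_ : (0 < #|Phi|)%N) : Type := Lambda -> Phi.

Variable hPhi : (0 < #|Phi|)%N.

HB.instance Definition _ := gen_eqMixin (config hPhi).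
HB.instance Definition _ := gen_choiceMixin (config hPhi).
HB.instance Definition _ :=
  isPointed.Build (config hPhi) (fun=> enum_val (Ordinal hPhi)).

Definition cylinder : set (set (config hPhi)) :=
  [set C | exists (N : {fset Lambda}) (B : set (N -> Phi)),
     C = [set s | B (fun x : N => s (val x))]].

Definition Omega : Type := g_sigma_algebraType cylinder.
HB.instance Definition _ := Measurable.copy Omega (g_sigma_algebraType cylinder).

Definition eqclass (M : {fset Lambda}) (s : Omega) : set Omega :=
  [set t | forall x, x \in M -> s x = t x].

End Config.

Arguments cylinder {Lambda Phi} hPhi _.

Section Operator.
Context {R : realType} {Lambda : countType} {Phi : finType}.
Context {hPhi : (0 < #|Phi|)%N}.
Local Notation Om := (Omega Lambda hPhi).
Implicit Types (mu lam : probability Om R) (M : {fset Lambda}).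

Definition pr mu (A : set Om) : R := fine (mu A).

Definition cylinder_positive mu :=
  forall B : set Om, cylinder hPhi B -> B !=set0 -> (0 < mu B)%E.

(* The class containing s1 is eqclass M s1, so the kernel does not depend on how
   the classes are numbered. *)
Definition kernelP mu M (s1 s2 s3 : Om) (A : set Om) : R :=
  let Oi := eqclass M s1 in
  let Oj := eqclass M s2 in
  let Ok := eqclass M s3 in
  (pr mu Oi * pr mu (A `&` Oi) + pr mu Oj * pr mu (A `&` Oj)
     + pr mu Ok * pr mu (A `&` Ok))
  / (pr mu Oi ^+ 2 + pr mu Oj ^+ 2 + pr mu Ok ^+ 2).

(* The positivity proof does not enter the value; it is an argument so that the
   probability instance below, which needs nonzero denominators in kernelP, can
   be attached to cso_measure. *)
Definition cso_measure mu M of cylinder_positive mu := fun lam (A : set Om) =>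
  (\int[lam]_s3 \int[lam]_s2 \int[lam]_s1 (kernelP mu M s1 s2 s3 A)%:E)%E.

Lemma cylinder_measurable (B : set Om) : cylinder hPhi B -> measurable B.
Proof. by move=> cB; apply: sub_sigma_algebra. Qed.

Lemma cylinder_saturated M (B : set Om) :
  (forall s t, eqclass M s t -> B s -> B t) -> cylinder hPhi B.
Proof.
move=> sB; exists M, [set f | exists2 s, B s & f = (fun x : M => s (val x))].
apply/seteqP; split => [s Bs|t [s Bs /funeqP E]] /=; first by exists s.
by apply: sB Bs => x xM; rewrite -(E [` xM]%fset).
Qed.

Lemma cylinder_eqclass M (s : Om) : cylinder hPhi (eqclass M s).
Proof.
by apply: (@cylinder_saturated M) => t u tu st x xM; rewrite st// tu.
Qed.

Lemma measurable_eqclass M (s : Om) : measurable (eqclass M s).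
Proof. by apply: cylinder_measurable; apply: cylinder_eqclass. Qed.

Lemma eqclass_eq M (s t : Om) : eqclass M s t -> eqclass M t = eqclass M s.
Proof.
by move=> st; apply/seteqP; split=> u su x xM; rewrite -su// st.
Qed.

Lemma measurable_fun_eqclass M (f : set Om -> \bar R) :
  measurable_fun [set: Om] (f \o eqclass M : Om -> \bar R).
Proof.
move=> _ Y _; rewrite setTI; apply: cylinder_measurable.
by apply: (@cylinder_saturated M) => s t st; rewrite /preimage/= (eqclass_eq st).
Qed.

Section Instances.
Context (mu : probability Om R) (M : {fset Lambda}).
Context (hmu : cylinder_positive mu) (lam : probability Om R).
Local Open Scope ereal_scope.
Local Notation Wl := (cso_measure M hmu lam).

Let prE (A : set Om) : measurable A -> (pr mu A)%:E = mu A.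
Proof. by move=> mA; rewrite fineK// fin_num_measure. Qed.

Let pr_ge0 (A : set Om) : (0 <= pr mu A)%R.
Proof. by apply: fine_ge0. Qed.

Let pr_gt0 s : (0 < pr mu (eqclass M s))%R.
Proof.
rewrite -lte_fin prE; last exact: measurable_eqclass.
by apply: hmu; [exact: cylinder_eqclass|exists s].
Qed.

Let den s1 s2 s3 := (pr mu (eqclass M s1) ^+ 2 + pr mu (eqclass M s2) ^+ 2
  + pr mu (eqclass M s3) ^+ 2)%R.

Let den_gt0 s1 s2 s3 : (0 < den s1 s2 s3)%R.
Proof. by rewrite !addr_gt0 // exprn_gt0. Qed.

Let kernel_ge0 s1 s2 s3 A : 0 <= (kernelP mu M s1 s2 s3 A)%:E.
Proof.
rewrite lee_fin divr_ge0 //; last exact/ltW/den_gt0.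
by rewrite !addr_ge0// mulr_ge0.
Qed.

Let I1 s2 s3 A := \int[lam]_s1 (kernelP mu M s1 s2 s3 A)%:E.
Let I2 s3 A := \int[lam]_s2 I1 s2 s3 A.

Let I1_ge0 s2 s3 A : 0 <= I1 s2 s3 A.
Proof. by apply: integral_ge0. Qed.

Let I2_ge0 s3 A : 0 <= I2 s3 A.
Proof. by apply: integral_ge0. Qed.

Let mk s2 s3 A : measurable_fun setT (fun s1 => (kernelP mu M s1 s2 s3 A)%:E).
Proof.
pose C2 := eqclass M s2; pose C3 := eqclass M s3.
exact: (@measurable_fun_eqclass M (fun C =>
  ((pr mu C * pr mu (A `&` C) + pr mu C2 * pr mu (A `&` C2)
     + pr mu C3 * pr mu (A `&` C3))
  / (pr mu C ^+ 2 + pr mu C2 ^+ 2 + pr mu C3 ^+ 2))%R%:E)).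
Qed.

Let mI1 s3 A : measurable_fun setT (fun s2 => I1 s2 s3 A).
Proof.
pose C3 := eqclass M s3.
exact: (@measurable_fun_eqclass M (fun C => \int[lam]_s1
  ((pr mu (eqclass M s1) * pr mu (A `&` eqclass M s1) + pr mu C * pr mu (A `&` C)
     + pr mu C3 * pr mu (A `&` C3))
  / (pr mu (eqclass M s1) ^+ 2 + pr mu C ^+ 2 + pr mu C3 ^+ 2))%R%:E)).
Qed.

Let mI2 A : measurable_fun setT (fun s3 => I2 s3 A).
Proof.
exact: (@measurable_fun_eqclass M (fun C => \int[lam]_s2 \int[lam]_s1
  ((pr mu (eqclass M s1) * pr mu (A `&` eqclass M s1)
     + pr mu (eqclass M s2) * pr mu (A `&` eqclass M s2) + pr mu C * pr mu (A `&` C))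
  / (pr mu (eqclass M s1) ^+ 2 + pr mu (eqclass M s2) ^+ 2 + pr mu C ^+ 2))%R%:E)).
Qed.

Let w s1 s2 s3 s : R := (pr mu (eqclass M s) / den s1 s2 s3)%R.

Let w_ge0 s1 s2 s3 s : (0 <= w s1 s2 s3 s)%R.
Proof. by rewrite divr_ge0//; exact/ltW/den_gt0. Qed.

Let part s1 s2 s3 s : {measure set Om -> \bar R} :=
  mscale (NngNum (w_ge0 s1 s2 s3 s)) (mrestr mu (measurable_eqclass M s)).

Let partE s1 s2 s3 s A : measurable A ->
  part s1 s2 s3 s A = (w s1 s2 s3 s * pr mu (A `&` eqclass M s))%:E.
Proof.
move=> mA; rewrite EFinM prE //; apply: measurableI => //.
exact: measurable_eqclass.
Qed.

Let kern s1 s2 s3 : {measure set Om -> \bar R} :=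
  measure_add (measure_add (part s1 s2 s3 s1) (part s1 s2 s3 s2))
    (part s1 s2 s3 s3).

Let kernelE s1 s2 s3 A : measurable A -> (kernelP mu M s1 s2 s3 A)%:E =
  kern s1 s2 s3 A.
Proof.
move=> mA; rewrite [RHS]measure_addE [X in _ = X + _]measure_addE !partE// -!EFinD.
congr (_%:E).
by rewrite /kernelP -/(den _ _ _) !mulrDl /w !(mulrAC _ _^-1%R).
Qed.

Let kernel_bigcup s1 s2 s3 (F : (set Om)^nat) : (forall n, measurable (F n)) ->
  trivIset setT F -> measurable (\bigcup_n F n) ->
  (kernelP mu M s1 s2 s3 (\bigcup_n F n))%:E =
  \sum_(n <oo) (kernelP mu M s1 s2 s3 (F n))%:E.
Proof.
move=> mF tF mU; rewrite kernelE// measure_semi_bigcup//.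
by apply: eq_eseriesr => n _; rewrite kernelE.
Qed.

Let kernel_setT s1 s2 s3 : kernelP mu M s1 s2 s3 setT = 1%R.
Proof.
by rewrite /kernelP !setTI -!expr2 divff// gt_eqF//; exact: den_gt0.
Qed.

Let W0 : Wl set0 = 0.
Proof.
rewrite /cso_measure.
under eq_integral do under eq_integral do under eq_integral do
  rewrite /kernelP !set0I /pr measure0 !mulr0 !addr0 mul0r.
under eq_integral do under eq_integral do rewrite integral0.
by under eq_integral do rewrite integral0; rewrite integral0.
Qed.

Let W_ge0 A : 0 <= Wl A.
Proof. by apply: integral_ge0 => s _; exact: I2_ge0. Qed.

Let W_sigma_additive : semi_sigma_additive Wl.
Proof.
move=> F mF tF mU.
suff -> : Wl (\bigcup_n F n) = \sum_(n <oo) Wl (F n).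
  by apply: is_cvg_ereal_nneg_natsum => n _; exact: W_ge0.
rewrite -(integral_nneseries _ measurableT (fun n => mI2 (F n))
  (fun n s _ => I2_ge0 s (F n))).
apply: eq_integral => s3 _.
rewrite -(integral_nneseries _ measurableT (fun n => mI1 s3 (F n))
  (fun n s _ => I1_ge0 s s3 (F n))).
apply: eq_integral => s2 _.
rewrite -(integral_nneseries _ measurableT (fun n => mk s2 s3 (F n))
  (fun n s _ => kernel_ge0 s s2 s3 (F n))).
by apply: eq_integral => s1 _; exact: kernel_bigcup.
Qed.

HB.instance Definition _ := isMeasure.Build _ _ _ Wl W0 W_ge0 W_sigma_additive.

Let W_setT : Wl setT = 1.
Proof.
have int1 : \int[lam]_x (1 : \bar R) = 1.
  by rewrite (integral_cst lam measurableT 1) mul1e; exact: probability_setT.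
rewrite /cso_measure -[RHS]int1; apply: eq_integral => s3 _.
rewrite -[RHS]int1; apply: eq_integral => s2 _.
by rewrite -[RHS]int1; apply: eq_integral => s1 _; rewrite kernel_setT.
Qed.

HB.instance Definition _ := Measure_isProbability.Build _ _ _ Wl W_setT.

End Instances.

Definition W mu M (hmu : cylinder_positive mu) (lam : probability Om R) :
  probability Om R := cso_measure M hmu lam.

Section Reduced.
Context (mu : probability Om R) {m : nat} (C : 'I_m -> set Om).

Definition coef_a i (A : set Om) : R := pr mu (A `&` C i) / pr mu (C i).

Definition coef_b i j (A : set Om) : R :=
  (2 * pr mu (C i) * pr mu (A `&` C i) + pr mu (C j) * pr mu (A `&` C j))
  / (2 * pr mu (C i) ^+ 2 + pr mu (C j) ^+ 2).

Definition coef_c i j k (A : set Om) : R :=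
  (pr mu (C i) * pr mu (A `&` C i) + pr mu (C j) * pr mu (A `&` C j)
     + pr mu (C k) * pr mu (A `&` C k))
  / (pr mu (C i) ^+ 2 + pr mu (C j) ^+ 2 + pr mu (C k) ^+ 2).

Definition cubic_form (A : set Om) (x : 'rV[R]_m) : R :=
  \sum_(i < m) coef_a i A * x ord0 i ^+ 3
  + 3 * \sum_(i < m) \sum_(j < m | j != i)
      coef_b i j A * x ord0 i ^+ 2 * x ord0 j
  + 6 * \sum_(i < m) \sum_(j < m | (i < j)%N) \sum_(k < m | (j < k)%N)
      coef_c i j k A * x ord0 i * x ord0 j * x ord0 k.

Definition V (x : 'rV[R]_m) : 'rV[R]_m := \row_l cubic_form (C l) x.

End Reduced.

Definition class_probs m (C : 'I_m -> set Om) lam : 'rV[R]_m :=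
  \row_i pr lam (C i).

(* C numbers the equivalence classes, each exactly once, in an arbitrary order. *)
Definition class_enum M (C : 'I_(#|Phi| ^ #|` M|) -> set Om) :=
  set_bij setT (range (eqclass M)) C.

Lemma class_enum_exists M :
  exists C : 'I_(#|Phi| ^ #|` M|) -> set Om, class_enum C.
Proof.
have cM : #|{ffun M -> Phi}| = (#|Phi| ^ #|` M|)%N by rewrite card_ffun cardfE.
pose f i := enum_val (cast_ord (esym cM) i).
pose ext (g : {ffun M -> Phi}) : Om := fun x =>
  if insub x is Some y then g y else enum_val (Ordinal hPhi).
have extE g (x : M) : ext g (val x) = g x by rewrite /ext valK.
exists (fun i => eqclass M (ext (f i))); split=> [i _ /=|i j _ _ /= E|_ [s _ <-]].
- by exists (ext (f i)).
- apply: (@cast_ord_inj _ _ (esym cM)); apply: enum_val_inj; apply/ffunP => x.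
  have : eqclass M (ext (f i)) (ext (f j)) by rewrite E => y.
  by move/(_ _ (valP x)); rewrite !extE.
- exists (cast_ord cM (enum_rank [ffun x : M => s (val x)])) => //=.
  apply/esym/eqclass_eq => x xM; rewrite /f cast_ordK enum_rankK.
  by rewrite (extE _ [` xM]%fset) ffunE.
Qed.

End Operator.

(* Main.v *)
Require Import Defs.
From mathcomp Require Import all_boot all_order all_algebra finmap.
From mathcomp Require Import all_classical all_reals all_analysis.
From mathcomp Require Import measurable_realfun ring.
Import Order.TTheory GRing.Theory Num.Theory.

Set Implicit Arguments.
Unset Strict Implicit.
Unset Printing Implicit Defensive.

(** The kernel is constant on products of three equivalence classes, so the
    triple integral is the finite sum over i, j, k of
    c_ijk(A) lam(C_i) lam(C_j) lam(C_k). The coefficients c_ijk are symmetric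
    and degenerate to b_ij and a_i when indices coincide; grouping the terms by
    the coincidence pattern of (i, j, k) gives the cubic form. *)

Local Open Scope classical_set_scope.
Local Open Scope ring_scope.

(** * Symmetric double and triple sums *)

Lemma sum_sym2 (R : comNzRingType) n (G : 'I_n -> 'I_n -> R) :
  (forall i j, G i j = G j i) ->
  \sum_i \sum_j G i j
  = \sum_i G i i + 2 * \sum_(i < n) \sum_(j < n | (i < j)%N) G i j.
Proof.
move=> Gsym; rewrite mulr2n mulrDl mul1r.
(* Swapping the indices exchanges the two triangles off the diagonal, which accounts for the factor
   2. *)
have lowerE : \sum_(i < n) \sum_(j < n | (i < j)%N) G i j
    = \sum_(i < n) \sum_(j < n | (j < i)%N) G i j.
  under eq_bigr do rewrite big_mkcond.
  rewrite exchange_big; apply: eq_bigr => i _; rewrite [RHS]big_mkcond.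
  by apply: eq_bigr => j _; rewrite Gsym.
rewrite {1}lowerE addrCA addrC -!big_split /=; apply: eq_bigr => i _.
rewrite (bigD1 i) //= -addrA; congr (_ + _).
rewrite (bigID (fun j : 'I_n => (i < j)%N)) /=; congr (_ + _);
  apply: eq_bigl => j.
- by rewrite -(inj_eq val_inj) neq_ltn; case: ltngtP.
- by rewrite -(inj_eq val_inj) neq_ltn; case: ltngtP.
Qed.

(** Induction on [n]: the last index [z] is split off in all three positions, and the terms are
    sorted by how many of their indices equal [z]. *)
Lemma sum_sym3 (R : comNzRingType) n (F : 'I_n -> 'I_n -> 'I_n -> R) :
  (forall i j k, F i j k = F j i k) -> (forall i j k, F i j k = F i k j) ->
  \sum_i \sum_j \sum_k F i j k
  = \sum_i F i i i + 3 * \sum_(i < n) \sum_(j < n | j != i) F i i j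
    + 6 * \sum_(i < n) \sum_(j < n | (i < j)%N) \sum_(k < n | (j < k)%N) F i j k.
Proof.
elim: n F => [|n IH] F F12 F23; first by rewrite !big_ord0 !mulr0 !addr0.
pose w := @widen_ord n n.+1 (leqnSn n); pose z : 'I_n.+1 := ord_max.
(* The terms with a single [z] form a symmetric double sum. Taken three times, its diagonal goes to
   the sum with factor 3, and its doubled triangle to the sum with factor 6. *)
have S2 : \sum_i \sum_j F (w i) (w j) z = \sum_i F (w i) (w i) z
    + 2 * \sum_(i < n) \sum_(j < n | (i < j)%N) F (w i) (w j) z.
  by apply: (@sum_sym2 _ _ (fun i j => F (w i) (w j) z)).
have S3 := IH (fun i j k => F (w i) (w j) (w k)) (fun _ _ _ => F12 _ _ _)
  (fun _ _ _ => F23 _ _ _).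
(* Zero, one, two or three indices equal [z]; by symmetry the three positions of a lone [z], or of a
   lone index other than [z], contribute equally. *)
have -> : \sum_i \sum_j \sum_k F i j k
    = \sum_i \sum_j \sum_k F (w i) (w j) (w k)
      + 3 * \sum_i \sum_j F (w i) (w j) z
      + 3 * \sum_i F z z (w i) + F z z z.
  rewrite big_ord_recr /= -/z.
  under eq_bigr do [rewrite big_ord_recr /= -/z;
    under eq_bigr do rewrite big_ord_recr /= -/z;
    rewrite big_ord_recr big_split /= -/z].
  rewrite !big_split /= big_ord_recr /= -/z.
  under [X in _ + (X + _)]eq_bigr do rewrite big_ord_recr /= -/z.
  rewrite big_split /= big_ord_recr /= -/z -/w.
  have zm : \sum_i \sum_j F (w i) z (w j) = \sum_i \sum_j F (w i) (w j) z.
    by apply: eq_bigr => i _; apply: eq_bigr => j _; rewrite F23.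
  have zl : \sum_i \sum_j F z (w i) (w j) = \sum_i \sum_j F (w i) (w j) z.
    by apply: eq_bigr => i _; apply: eq_bigr => j _; rewrite F12 F23.
  have zzl : \sum_i F (w i) z z = \sum_i F z z (w i).
    by apply: eq_bigr => i _; rewrite F12 F23.
  have zzm : \sum_i F z (w i) z = \sum_i F z z (w i).
    by apply: eq_bigr => i _; rewrite F23.
  rewrite zm zl zzl zzm; ring.
rewrite S3 S2.
have -> : \sum_i F i i i = \sum_i F (w i) (w i) (w i) + F z z z.
  by rewrite big_ord_recr.
(* Here [z] is either absent, or the single index, or the repeated one. *)
have -> : \sum_(i < n.+1) \sum_(j < n.+1 | j != i) F i i j
    = \sum_(i < n) \sum_(j < n | j != i) F (w i) (w i) (w j)
      + \sum_i F (w i) (w i) z + \sum_i F z z (w i).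
  rewrite big_ord_recr /= -/z; congr (_ + _); last first.
    rewrite big_mkcond big_ord_recr /= eqxx addr0; apply: eq_bigr => i _.
    by rewrite -(inj_eq val_inj) /= neq_ltn ltn_ord.
  rewrite -big_split /=; apply: eq_bigr => i _.
  rewrite big_mkcond big_ord_recr /= -big_mkcond /=; congr (_ + _).
  by rewrite -(inj_eq val_inj) /= neq_ltn ltn_ord orbT.
(* Since [z] is the largest index, it can occur in an increasing triple only as the last entry. *)
have -> : \sum_(i < n.+1) \sum_(j < n.+1 | (i < j)%N) \sum_(k < n.+1 | (j < k)%N) F i j k
    = \sum_(i < n) \sum_(j < n | (i < j)%N) \sum_(k < n | (j < k)%N)
        F (w i) (w j) (w k)
      + \sum_(i < n) \sum_(j < n | (i < j)%N) F (w i) (w j) z.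
  rewrite big_ord_recr /= [X in _ + X]big1 ?addr0; last first.
    by move=> j; rewrite ltnNge -ltnS ltn_ord.
  rewrite -big_split /=; apply: eq_bigr => i _.
  rewrite big_mkcond big_ord_recr /= -big_mkcond /= ltn_ord.
  rewrite [X in _ + X]big1 ?addr0; last first.
    by move=> j; rewrite ltnNge -ltnS ltn_ord.
  rewrite -big_split /=; apply: eq_bigr => j _.
  by rewrite big_mkcond big_ord_recr /= -big_mkcond /= ltn_ord.
ring.
Qed.

(** * The enumerated classes as a finite measurable partition *)

Section Classes.
Context {R : realType} {Lambda : countType} {Phi : finType}.
Context {hPhi : (0 < #|Phi|)%N}.
Local Notation Om := (Omega Lambda hPhi).
Context {M : {fset Lambda}} {C : 'I_(#|Phi| ^ #|` M|) -> set Om}.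
Hypothesis hC : class_enum C.

Lemma class_enumE i s : C i s -> eqclass M s = C i.
Proof.
case: hC => hfun _ _; case: (hfun i I) => t _ <-; exact: eqclass_eq.
Qed.

Lemma class_enum_nonempty i : C i !=set0.
Proof. by case: hC => hfun _ _; case: (hfun i I) => t _ <-; exists t. Qed.

Lemma class_enum_cover s : exists i, C i s.
Proof.
case: hC => _ _ hsurj; have [|i _ Ci] := hsurj (eqclass M s); first by exists s.
by exists i; rewrite Ci.
Qed.

Lemma class_enum_inj i j s : C i s -> C j s -> i = j.
Proof.
move=> Cis Cjs; case: hC => _ hinj _; apply: hinj; rewrite ?inE//.
by rewrite -(class_enumE Cis) (class_enumE Cjs).
Qed.

Lemma cylinder_class_enum i : cylinder hPhi (C i).
Proof.
have [s Cs] := class_enum_nonempty i.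
by rewrite -(class_enumE Cs); exact: cylinder_eqclass.
Qed.

Lemma measurable_class_enum i : measurable (C i).
Proof. by apply: cylinder_measurable; exact: cylinder_class_enum. Qed.

Lemma class_enum_setI i j : i != j -> C i `&` C j = set0.
Proof.
move=> /eqP ij; rewrite -subset0 => s [Cis Cjs].
by case: ij; exact: class_enum_inj Cis Cjs.
Qed.

(** The classes are finitely many, disjoint and measurable, so the integral splits over them into
    integrals of constants. This evaluates each of the three nested integrals of the kernel. *)
Lemma integral_class_enum (lam : probability Om R) (f : Om -> \bar R)
    (v : _ -> R) :
  (forall i, 0 <= v i) -> (forall i s, C i s -> f s = (v i)%:E) ->
  (\int[lam]_s f s)%E = (\sum_i v i * pr lam (C i))%:E.
Proof.
move=> v0 fv.
have setTE : [set: Om] = \big[setU/set0]_(i <- enum 'I_(#|Phi| ^ #|` M|)) C i.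
  apply/esym/seteqP; split=> // s _; have [i Cis] := class_enum_cover s.
  by rewrite -bigcup_seq; exists i => //=; rewrite mem_enum.
(* Every preimage under [f] is a union of classes, hence a cylinder over [M]. *)
have mf : measurable_fun [set: Om] f.
  move=> _ Y _; rewrite setTI; apply: cylinder_measurable.
  apply: (@cylinder_saturated _ _ _ M) => s t st; rewrite /preimage /=.
  have [i Cis] := class_enum_cover s.
  suff Cit : C i t by rewrite (fv _ _ Cis) (fv _ _ Cit).
  by rewrite -(class_enumE Cis).
rewrite setTE ge0_integral_bigsetU //=.
- rewrite big_enum /= -sumEFin; apply: eq_bigr => i _.
  under eq_integral => s; first rewrite inE => /fv ->; first over.
  rewrite integral_cst; last exact: measurable_class_enum.
  rewrite EFinM /pr fineK// fin_num_measure//; exact: measurable_class_enum.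
- exact: measurable_class_enum.
- exact: enum_uniq.
- by move=> i j _ _ [s [Cis Cjs]]; exact: class_enum_inj Cis Cjs.
- by rewrite -setTE.
- by move=> s _; have [i /fv ->] := class_enum_cover s; rewrite lee_fin.
Qed.

(** * Coefficients and the cubic form *)

Context (mu : probability Om R).
Hypothesis hmu : cylinder_positive mu.

Lemma pr_class_gt0 i : 0 < pr mu (C i).
Proof.
rewrite fine_gt0// -ge0_fin_numE// fin_num_measure ?andbT//.
- by apply: hmu; [exact: cylinder_class_enum|exact: class_enum_nonempty].
- exact: measurable_class_enum.
Qed.

Lemma pr_ge0 A : 0 <= pr mu A.
Proof. exact: fine_ge0. Qed.

Lemma coef_c_den_gt0 i j k :
  0 < pr mu (C i) ^+ 2 + pr mu (C j) ^+ 2 + pr mu (C k) ^+ 2.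
Proof. by rewrite !addr_gt0// exprn_gt0// pr_class_gt0. Qed.

Lemma coef_c_ge0 i j k A : 0 <= coef_c mu C i j k A.
Proof.
by rewrite divr_ge0 ?(ltW (coef_c_den_gt0 _ _ _))// !addr_ge0// mulr_ge0// pr_ge0.
Qed.

Lemma coef_c_diag i A : coef_c mu C i i i A = coef_a mu C i A.
Proof.
have p0 := lt0r_neq0 (pr_class_gt0 i); have d0 := lt0r_neq0 (coef_c_den_gt0 i i i).
by rewrite /coef_c /coef_a; field; rewrite p0.
Qed.

Lemma coef_c_pair i j A : coef_c mu C i i j A = coef_b mu C i j A.
Proof. by rewrite /coef_c /coef_b; congr (_ / _); ring. Qed.

Lemma coef_cC i j k A : coef_c mu C i j k A = coef_c mu C j i k A.
Proof. by rewrite /coef_c; congr (_ / _); ring. Qed.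

Lemma coef_cAC i j k A : coef_c mu C i j k A = coef_c mu C i k j A.
Proof. by rewrite /coef_c; congr (_ / _); ring. Qed.

(** The summand is symmetric in its three indices, so [sum_sym3] applies. The full triple sum is the
    shape shared by [cso] and by the iterated integral. *)
Lemma cubic_formE A x : cubic_form mu C A x
  = \sum_i \sum_j \sum_k
      coef_c mu C i j k A * x ord0 i * x ord0 j * x ord0 k.
Proof.
rewrite sum_sym3.
- rewrite /cubic_form; congr (_ + _ * _ + _).
  + by apply: eq_bigr => i _; rewrite coef_c_diag; ring.
  + apply: eq_bigr => i _; apply: eq_bigr => j _; rewrite coef_c_pair; ring.
- by move=> i j k; rewrite coef_cC; ring.
- by move=> i j k; rewrite coef_cAC; ring.
Qed.

(** * Evaluation of the operator and the Volterra property *)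

Lemma kernelP_class i j k s1 s2 s3 A : C i s1 -> C j s2 -> C k s3 ->
  kernelP mu M s1 s2 s3 A = coef_c mu C i j k A.
Proof.
move=> /class_enumE E1 /class_enumE E2 /class_enumE E3.
by rewrite /kernelP E1 E2 E3.
Qed.

Lemma W_cubic_form lam A :
  W M hmu lam A = (cubic_form mu C A (class_probs C lam))%:E.
Proof.
pose p i := pr lam (C i).
have p0 i : 0 <= p i by exact: fine_ge0.
(* [v2 j k] is the innermost integral for [s2] in [C j] and [s3] in [C k]; [v3 k] below is the
   double integral for [s3] in [C k]. *)
pose v2 j k := \sum_i coef_c mu C i j k A * p i.
have v2_ge0 j k : 0 <= v2 j k.
  by apply: sumr_ge0 => i _; rewrite mulr_ge0// coef_c_ge0.
pose v3 k := \sum_j v2 j k * p j.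
have v3_ge0 k : 0 <= v3 k by apply: sumr_ge0 => j _; rewrite mulr_ge0.
transitivity (\sum_k v3 k * p k)%:E.
  apply: integral_class_enum => // k s3 Ck.
  apply: integral_class_enum => // j s2 Cj.
  apply: integral_class_enum => [i|i s1 Ci]; first exact: coef_c_ge0.
  by rewrite (kernelP_class _ Ci Cj Ck).
rewrite cubic_formE; congr _%:E.
under eq_bigr do rewrite /v3 mulr_suml;
  under eq_bigr do under eq_bigr do rewrite /v2 !mulr_suml.
(* Integration yields the sums with [k] outermost and [i] innermost; three exchanges reverse this
   order. *)
under eq_bigr do rewrite exchange_big.
rewrite exchange_big; apply: eq_bigr => i _ /=; rewrite exchange_big.
by apply: eq_bigr => j _; apply: eq_bigr => k _; rewrite !mxE.
Qed.

Lemma sum_pr_classI i : \sum_l pr mu (C l `&` C i) = pr mu (C i).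
Proof.
rewrite (bigD1 i) //= setIid big1 ?addr0// => l li.
by rewrite class_enum_setI// /pr measure0.
Qed.

Lemma volterra_V : volterra_cso (V mu C).
Proof.
(* Summed over [l], the numerator becomes the sum of squares in the denominator, because [C l] meets
   [C i] only for [l = i]. The same disjointness makes the numerator vanish when [l] is none of [i],
   [j], [k]. *)
exists (fun i j k l => coef_c mu C i j k (C l)); split.
- split=> [i j k l|i j k]; first exact: coef_c_ge0.
  rewrite -mulr_suml !big_split /= -!mulr_sumr !sum_pr_classI -!expr2.
  by rewrite divff// gt_eqF// coef_c_den_gt0.
- move=> i j k l; rewrite !inE !negb_or => /and3P[li lj lk].
  by rewrite /coef_c !class_enum_setI// /pr measure0 !mulr0 !addr0 mul0r.
- by move=> x _; apply/rowP => l; rewrite !mxE cubic_formE.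
Qed.

End Classes.

Theorem theorem3p1 (R : realType) (Lambda : countType) (Phi : finType)
    (hPhi : (0 < #|Phi|)%N) (mu : probability (Omega Lambda hPhi) R)
    (hmu : cylinder_positive mu) (M : {fset Lambda})
    (C : 'I_(#|Phi| ^ #|` M|) -> set (Omega Lambda hPhi))
    (hC : class_enum C) :
  volterra_cso (V mu C) /\
  forall lam : probability (Omega Lambda hPhi) R,
    (forall n, class_probs C (iter n (W M hmu) lam) =
               iter n (V mu C) (class_probs C lam)) /\
    (forall n (A : set (Omega Lambda hPhi)), measurable A ->
       iter n.+1 (W M hmu) lam A =
       (cubic_form mu C A (class_probs C (iter n (W M hmu) lam)))%:E).
Proof.
split; first exact: volterra_V.
move=> lam; split=> [n|n A _]; last exact: W_cubic_form.
(* The formula for [W] at [A = C l] is the coordinate [l] of [V]. *)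
elim: n => //= n <-; apply/rowP => l.
by rewrite !mxE /pr (W_cubic_form hC).
Qed.
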